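(* Let $0<\alpha<1$, let $\Omega\subset\mathbb{R}^N$ be a convex domain, let $u:\overline{\Omega}\to\mathbb{R}$ be an $\alpha$-convex function and let $f:\mathbb{R}\to\mathbb{R}$ be a smooth function such that for all $s\in\mathbb{R}$ $$f'(s)\ge0\qquad\text{and}\qquad \alpha f''(s)+(1-\alpha)\big[(f'(s))^2-f'(s)\big]\ge0.$$ Then the composition $f\circ u:\overline{\Omega}\to\mathbb{R}$ is also $\alpha$-convex.
   Context: Let $L_\alpha(v)(t)=\alpha v''(t)+(1-\alpha)|v'(t)|^2$. A function $u:\overline{\Omega}\to\mathbb{R}$ is $\alpha$-convex ($0<\alpha<1$) if for any $x,y\in\overline{\Omega}$ one has $u(tx+(1-t)y)\le v(t)$ for all $t\in(0,1)$, where $v$ is the (unique classical) solution of $L_\alpha(v)=0$ in $(0,1)$ with $v(0)=u(y)$, $v(1)=u(x)$. *)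

(* Defs.v *)
From HB Require Import structures.
From mathcomp Require Import all_boot all_order all_algebra.
From mathcomp Require Import all_classical all_reals all_analysis.

Set Implicit Arguments.
Unset Strict Implicit.
Unset Printing Implicit Defensive.

Import Order.TTheory GRing.Theory Num.Theory.
Import numFieldNormedType.Exports.

Local Open Scope classical_set_scope.
Local Open Scope ring_scope.

Definition domain (T : topologicalType) (A : set T) : Prop :=
  [/\ open A, connected A & A !=set0].

Definition smooth (R : realType) (f : R -> R) : Prop :=
  forall (n : nat) (s : R), derivable f^`(n)%classic s 1.

Definition Lop (R : realType) (alpha : R) (v : R -> R) (t : R) : R :=
  alpha * v^`(2)%classic t + (1 - alpha) * `|v^`()%classic t| ^+ 2.

(* Classical solution, i.e. v in C^2(]0, 1[) and C([0, 1]), of L_alpha(v) = 0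
   with v(0) = a and v(1) = b. Only the values of v on [0, 1] matter. *)
Definition Lop_solution (R : realType) (alpha a b : R) (v : R -> R) : Prop :=
  [/\ {within `[0, 1], continuous v},
      {in `]0, 1[, forall t, derivable v t 1 /\ derivable v^`()%classic t 1},
      {in `]0, 1[, continuous v^`(2)%classic},
      {in `]0, 1[, forall t, Lop alpha v t = 0}
    & v 0 = a /\ v 1 = b].

(* Functions on the closure of Omega are represented by total functions whose
   values elsewhere are never used when Omega is convex. Quantifying over all v
   is harmless: for 0 < alpha < 1 and k = (1 - alpha) / alpha, the boundary
   value problem has exactly one solution on [0, 1], namely
   v(t) = ln ((1 - t) * expR (k * u y) + t * expR (k * u x)) / k. *)
Definition alpha_convex (R : realType) (N : nat) (alpha : R)
    (Omega : set 'rV[R]_N) (u : 'rV[R]_N -> R) : Prop :=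
  forall x y : 'rV[R]_N, closure Omega x -> closure Omega y ->
  forall v : R -> R, Lop_solution alpha (u y) (u x) v ->
  forall t : R, 0 < t < 1 -> u (t *: x + (1 - t) *: y) <= v t.

(* Main.v *)
(* With k = (1 - alpha) / alpha one has
   (exp (k v))'' = (k / alpha) exp (k v) L_alpha v, so for a subsolution v1
   and a supersolution v2 of L_alpha the difference exp (k v1) - exp (k v2) is
   convex, and v1 <= v2 follows from the boundary values. If L_alpha w = 0 then
   L_alpha (f o w) = (alpha f'' + (1 - alpha) (f'^2 - f')) (w) w'^2 >= 0, so
   taking for w the solution with boundary values of u, f (u z) <= f (w t) by
   monotonicity of f, and f (w t) <= v t by comparison. *)
Require Import Defs.
From HB Require Import structures.
From mathcomp Require Import all_boot all_order all_algebra.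
From mathcomp Require Import all_classical all_reals all_analysis.
From mathcomp Require Import ring.

Import Order.TTheory GRing.Theory Num.Theory.
Import numFieldNormedType.Exports.

Local Open Scope classical_set_scope.
Local Open Scope ring_scope.

(** Each point of an open interval has a neighbourhood on which f' coincides with [g], so f'
    inherits the derivative of [g] there. This turns explicit derivative formulas, valid only
    between [a] and [b], into values of the derivation operators. *)
Lemma derive1_oo (R : realType) (a b : R) (f g h : R -> R) :
  {in `]a, b[, forall t : R, is_derive t 1 f (g t)} ->
  {in `]a, b[, forall t : R, is_derive t 1 g (h t)} ->
  {in `]a, b[, forall t : R,
    [/\ derivable f t 1, derivable f^`()%classic t 1, f^`()%classic t = g t
      & f^`(2)%classic t = h t]}.
Proof.
move=> fg gh t tab.
have f'E s : s \in `]a, b[ -> f^`()%classic s = g s.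
  by move=> sab; have ? := fg _ sab; rewrite derive1E derive_val.
have ? : is_derive t 1 f^`()%classic (h t).
  apply: near_eq_is_derive (gh _ tab).
  by near=> s; apply/esym/f'E; near: s; exact: near_in_itvoo.
split; rewrite ?f'E//; first by have [] := fg _ tab.
by rewrite derive1nS derive1E derive_val.
Unshelve. all: by end_near. Qed.

Lemma is_derive_derive1 (R : realType) (f : R -> R) (t : R) :
  derivable f t 1 -> is_derive t 1 f (f^`()%classic t).
Proof. by move=> ft; apply: DeriveDef; [exact: ft|rewrite derive1E]. Qed.

(** A convex function lies below its chord, and a chord with nonpositive endpoints is
    nonpositive. *)
Lemma le0_of_convex (R : realType) (a b : R) (h h1 h2 : R -> R) :
  {within `[a, b], continuous h} ->
  {in `]a, b[, forall t : R, is_derive t 1 h (h1 t)} ->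
  {in `]a, b[, forall t : R, is_derive t 1 h1 (h2 t)} ->
  {in `]a, b[, forall t : R, 0 <= h2 t} ->
  h a <= 0 -> h b <= 0 -> {in `]a, b[, forall t : R, h t <= 0}.
Proof.
move=> hc hh1 hh2 h2ge0 ha hb t tab.
have ab : a < b by move: tab; rewrite in_itv/= => /andP[]; exact: lt_trans.
have [_ hca hcb] := (continuous_within_itvP h ab).1 hc.
have D := @derive1_oo R a b h h1 h2 hh1 hh2.
have DE : 'D_1 h = h^`()%classic by apply/funext => s; rewrite derive1E.
move: tab (tab); rewrite {1}in_itv/= => /andP[at_ tb] tab.
(* The quotient is the barycentric weight of [a] when [t] is written as a convex combination of [a]
   and [b]. *)
have s0 : 0 <= (b - t) / (b - a).
  by rewrite divr_ge0// subr_ge0 ltW.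
have s1 : (b - t) / (b - a) <= 1.
  by rewrite ler_pdivrMr ?subr_gt0// mul1r lerD2l lerN2 ltW.
have := @second_derivative_convex R h a b _ hcb hca _ _ (Itv01 s0 s1)
  (ltW ab).
rewrite !convRE /=.
have -> : (b - t) / (b - a) * a + (1 - (b - t) / (b - a)) * b = t.
  by field; rewrite subr_eq0 gt_eqF.
move=> convh; apply: (le_trans (convh _ _ _)).
- move=> x xab; rewrite DE -derive1E -[leRHS]/(h^`(2)%classic x).
  by have [|_ _ _ ->] := D x; rewrite ?h2ge0 ?in_itv.
- by move=> x /D[hx _ _ _]; exact: hx.
- by rewrite DE => x /D[_ h'x _ _]; exact: h'x.
- by rewrite -oppr_ge0 opprD addr_ge0// -mulrN mulr_ge0 ?subr_ge0 ?oppr_ge0.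
Qed.

Lemma is_derive_expRM (R : realType) (k : R) (f : R -> R) (t d : R) :
  is_derive t 1 f d ->
  is_derive t 1 (fun s => expR (k * f s)) (k * d * expR (k * f t)).
Proof.
move=> ft; have kf := @is_deriveZ _ _ _ f k t 1 d ft.
have := @is_derive1_comp _ _ (k \*: f) _ _ _ (is_derive_expR _) kf.
by rewrite [_ *: _]/(k * d) mulrC.
Qed.

Lemma is_derive2_expRM (R : realType) (k : R) (f f1 : R -> R) (t f2 : R) :
  is_derive t 1 f (f1 t) -> is_derive t 1 f1 f2 ->
  is_derive t 1 (fun s => k * f1 s * expR (k * f s))
    (k * (f2 + k * f1 t ^+ 2) * expR (k * f t)).
Proof.
move=> ft f1t; have e := @is_derive_expRM _ k _ _ _ ft.
have kf := @is_deriveZ _ _ _ f1 k t 1 f2 f1t.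
apply: is_derive_eq (is_deriveM kf e) _.
rewrite -[LHS]/(k * f1 t * (k * f1 t * expR (k * f t)) +
  expR (k * f t) * (k * f2)).
by ring.
Qed.

Lemma Lop_comparison (R : realType) (alpha : R) (v w : R -> R) :
  0 < alpha < 1 ->
  {within `[0, 1], continuous v} -> {within `[0, 1], continuous w} ->
  {in `]0, 1[, forall t : R, derivable v t 1 /\ derivable v^`()%classic t 1} ->
  {in `]0, 1[, forall t : R, derivable w t 1 /\ derivable w^`()%classic t 1} ->
  {in `]0, 1[, forall t : R, 0 <= Lop alpha v t} ->
  {in `]0, 1[, forall t : R, Lop alpha w t <= 0} ->
  v 0 <= w 0 -> v 1 <= w 1 -> {in `]0, 1[, forall t : R, v t <= w t}.
Proof.
move=> /andP[a0 a1] vc wc vd wd Lv Lw vw0 vw1 t t01.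
set k := (1 - alpha) / alpha.
have k0 : 0 < k by rewrite divr_gt0// subr_gt0.
have expRM_le (x y : R) : (expR (k * x) <= expR (k * y)) = (x <= y).
  by rewrite ler_expR ler_pM2l.
(* By the choice of [k], [alpha * k] is [1 - alpha]. *)
have LopE (f : R -> R) s : alpha * (f^`(2)%classic s + k * f^`()%classic s ^+ 2)
    = Lop alpha f s.
  by rewrite /Lop real_normK ?num_real// /k; field; rewrite gt_eqF.
have expc (f : R -> R) : {within `[0, 1], continuous f} ->
    {within `[0, 1], continuous (fun s => expR (k * f s))}.
  move=> fc x; apply: continuous_comp; last exact: continuous_expR.
  by apply: cvgMr; exact: fc.
rewrite -expRM_le -subr_le0.
(* [h1 f] and [h2 f] are the first two derivatives of [expR (k * f s)] in [s]. *)
pose h1 (f : R -> R) s := k * f^`()%classic s * expR (k * f s).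
pose h2 (f : R -> R) s :=
  k * (f^`(2)%classic s + k * f^`()%classic s ^+ 2) * expR (k * f s).
have Dh (f : R -> R) (s : R) : derivable f s 1 /\ derivable f^`()%classic s 1 ->
    is_derive s 1 (fun s => expR (k * f s)) (h1 f s) /\
    is_derive s 1 (h1 f) (h2 f s).
  move=> [/is_derive_derive1 f1s /is_derive_derive1 f2s].
  by split; [exact: is_derive_expRM|exact: is_derive2_expRM].
apply: (@le0_of_convex _ 0 1 (fun s => expR (k * v s) - expR (k * w s))
  (fun s => h1 v s - h1 w s) (fun s => h2 v s - h2 w s)); last exact: t01.
- by move=> x; apply: cvgB; [exact: expc vc x|exact: expc wc x].
- move=> s s01; have [vs _] := Dh _ _ (vd _ s01).
  by have [ws _] := Dh _ _ (wd _ s01); exact: is_deriveB.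
- move=> s s01; have [_ vs] := Dh _ _ (vd _ s01).
  by have [_ ws] := Dh _ _ (wd _ s01); exact: is_deriveB.
(* Zero separates the two second derivatives: [h2 f] has the sign of [Lop alpha f], since [k],
   [alpha] and the exponential are positive. *)
- move=> s s01; rewrite subr_ge0 (@le_trans _ _ 0)//.
    rewrite /h2 pmulr_lle0 ?expR_gt0// pmulr_rle0// -(pmulr_rle0 _ a0) LopE.
    exact: Lw.
  rewrite /h2 pmulr_lge0 ?expR_gt0// pmulr_rge0// -(pmulr_rge0 _ a0) LopE.
  exact: Lv.
- by rewrite subr_le0 expRM_le.
- by rewrite subr_le0 expRM_le.
Qed.

(** The equation says that [expR (k * w t)] is affine in [t], so a solution is obtained by
    interpolating linearly between the exponentials of the boundary data and taking the
    logarithm. *)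
Lemma Lop_solution_exists (R : realType) (alpha a b : R) :
  0 < alpha < 1 -> exists w, Lop_solution alpha a b w.
Proof.
move=> /andP[a0 a1]; set k := (1 - alpha) / alpha.
have k0 : k != 0 by rewrite gt_eqF// divr_gt0// subr_gt0.
set A := expR (k * a); set c := expR (k * b) - A.
pose q (t : R) := A + c * t.
pose w t := k^-1 * ln (q t).
(* These are w' and w''; the shape of [w2] is the equation itself, w'' = - k w'^2. *)
pose w1 t := k^-1 * c * (q t)^-1.
pose w2 t := - k * (w1 t * w1 t).
have qE t : q t = (1 - t) * expR (k * a) + t * expR (k * b).
  by rewrite /q /c /A; ring.
(* At [t = 0] only the first term of the interpolation is positive; for [t > 0] the second one is,
   and the first is nonnegative. *)
have q_gt0 t : 0 <= t <= 1 -> 0 < q t.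
  move=> /andP[]; rewrite le_eqVlt => /predU1P[<- _|t0 t1].
    by rewrite qE mul0r addr0 subr0 mul1r expR_gt0.
  by rewrite qE ltr_wpDl ?mulr_gt0 ?mulr_ge0 ?subr_ge0 ?expR_gt0 ?expR_ge0.
have q_oo t : t \in `]0, 1[ -> 0 < q t.
  by rewrite in_itv/= => /andP[t0 t1]; rewrite q_gt0// !ltW.
have dq (t : R) : is_derive t 1 q c.
  have ct := @is_deriveZ _ _ _ id c t 1 1 (is_derive_id t 1).
  apply: is_derive_eq (is_deriveD (is_derive_cst A t 1) ct) _.
  by rewrite add0r [_ *: _]mulr1.
have dw (t : R) : 0 < q t -> is_derive t 1 w (w1 t).
  move=> qt; have lnq := is_derive1_comp (is_derive1_ln qt) (dq t).
  apply: is_derive_eq (@is_deriveZ _ _ _ (@ln R \o q) k^-1 _ _ _ lnq) _.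
  by rewrite /w1 -mulrA (mulrC c).
have dw1 (t : R) : 0 < q t -> is_derive t 1 w1 (w2 t).
  move=> qt; have qt0 : q t != 0 by rewrite gt_eqF.
  have dqV := @is_deriveV _ q t c 1 qt0 (dq t).
  apply: is_derive_eq
    (@is_deriveZ _ _ _ (fun s => (q s)^-1) (k^-1 * c) _ _ _ dqV) _.
  by rewrite /GRing.scale /= /w2 /w1; field; rewrite qt0 k0.
have D := @derive1_oo R 0 1 w w1 w2 (fun t t01 => dw t (q_oo t t01))
  (fun t t01 => dw1 t (q_oo t t01)).
exists w; split.
(* As [q] is affine on the whole line and positive on the closed interval, [w] is derivable even at
   the endpoints. *)
- apply: derivable_within_continuous => t; rewrite in_itv/= => /q_gt0 /dw.
  by case.
- by move=> t /D[].
(* [w2] is continuous at [t] because [w1] is derivable there; continuity passes to w'', which equals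
   [w2] near [t]. *)
- move=> t t01; have [_ _ _ w2t] := D t t01.
  have [/derivable1_diffP/differentiable_continuous w1c _] := dw1 t (q_oo t t01).
  have w2c : w2 x @[x --> t] --> w2 t by apply: cvgMr; exact: cvgM.
  rewrite /continuous_at w2t; apply: cvg_trans w2c; apply: near_eq_cvg.
  near=> s; have [|_ _ _ <-//] := D s.
  by near: s; exact: near_in_itvoo.
- move=> t /D[_ _ w1E w2E]; rewrite /Lop w1E w2E real_normK ?num_real//.
  by rewrite /w2 /k; field; rewrite gt_eqF.
- rewrite /w !qE !subrr !subr0 !mul0r !mul1r addr0 add0r !expRK.
  by split; exact: mulKf.
Unshelve. all: by end_near. Qed.

Lemma derive2_comp (R : realType) (a b : R) (f w : R -> R) :
  (forall s : R, derivable f s 1) ->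
  (forall s : R, derivable f^`()%classic s 1) ->
  {in `]a, b[, forall t : R, derivable w t 1 /\ derivable w^`()%classic t 1} ->
  {in `]a, b[, forall t : R,
    [/\ derivable (f \o w) t 1, derivable (f \o w)^`()%classic t 1,
      (f \o w)^`()%classic t = f^`()%classic (w t) * w^`()%classic t
    & (f \o w)^`(2)%classic t = f^`(2)%classic (w t) * w^`()%classic t ^+ 2
        + f^`()%classic (w t) * w^`(2)%classic t]}.
Proof.
move=> fd fdd wd.
apply: (@derive1_oo R a b (f \o w)
  (fun t => f^`()%classic (w t) * w^`()%classic t)
  (fun t => f^`(2)%classic (w t) * w^`()%classic t ^+ 2
        + f^`()%classic (w t) * w^`(2)%classic t)) => t /wd[wt w't].
  exact: is_derive1_comp (is_derive_derive1 _ _ _ (fd (w t)))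
    (is_derive_derive1 _ _ _ wt).
have f'w := is_derive1_comp (is_derive_derive1 _ _ _ (fdd (w t)))
  (is_derive_derive1 _ _ _ wt).
apply: is_derive_eq (is_deriveM f'w (is_derive_derive1 _ _ _ w't)) _.
rewrite [X in X + _](_ : _ = f^`()%classic (w t) * w^`(2)%classic t)//.
rewrite [X in _ + X](_ : _ =
  w^`()%classic t * (f^`(2)%classic (w t) * w^`()%classic t))//.
by rewrite addrC expr2 mulrC mulrA.
Qed.

Theorem proposition2p24 (R : realType) (N : nat) (alpha : R)
    (Omega : set 'rV[R]_N) (u : 'rV[R]_N -> R) (f : R -> R)
    (halpha : 0 < alpha < 1)
    (hdom : domain Omega) (hconv : convex_set Omega)
    (hu : alpha_convex alpha Omega u)
    (hf : smooth f)
    (hf1 : forall s : R, 0 <= f^`()%classic s)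
    (hf2 : forall s : R,
      0 <= alpha * f^`(2)%classic s
           + (1 - alpha) * ((f^`()%classic s) ^+ 2 - f^`()%classic s)) :
  alpha_convex alpha Omega (f \o u).
Proof.
move=> x y Ox Oy v [vc vd _ Lv [v0 v1]] t t01.
have [w solw] := @Lop_solution_exists R alpha (u y) (u x) halpha.
have [wc wd _ Lw [w0 w1]] := solw.
have fd (s : R) : derivable f s 1 := hf 0%N s.
have fc : continuous f.
  by move=> s; apply/differentiable_continuous/derivable1_diffP.
have D := @derive2_comp R 0 1 f w fd (hf 1%N) wd.
have f_le : {homo f : r s / r <= s}.
  move=> r s rs; apply: (@ger0_derive1_ndecr _ f r s) => //.
  by apply: continuous_subspaceT.
apply: (@le_trans _ _ (f (w t))).
  by apply: f_le; exact: hu solw _ t01.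
have fwc : {within `[0, 1], continuous (f \o w)}.
  by move=> s; apply: continuous_cvg; [exact: fc|exact: wc].
have fwd : {in `]0, 1[, forall s : R,
    derivable (f \o w) s 1 /\ derivable (f \o w)^`()%classic s 1}.
  by move=> s /D[fws fw's _ _]; split; [exact: fws|exact: fw's].
(* It remains to see that [f \o w] is a subsolution; its boundary values are exactly those of
   [v]. *)
apply: (@Lop_comparison R alpha (f \o w) v halpha fwc vc fwd vd).
- move=> s s01; have [_ _ fw1 fw2] := D s s01; have := Lw s s01.
  rewrite /Lop fw1 fw2 !real_normK ?num_real// => /eqP.
  (* The equation for [w] replaces alpha w'' by - (1 - alpha) w'^2; every term then carries the
     factor w'^2, whose coefficient is the expression in [hf2] at [w s]. *)
  rewrite addr_eq0 => /eqP w2E.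
  rewrite mulrDr (mulrCA alpha _ (w^`(2)%classic s)) w2E.
  have -> : alpha * (f^`(2)%classic (w s) * w^`()%classic s ^+ 2)
      + f^`()%classic (w s) * - ((1 - alpha) * w^`()%classic s ^+ 2)
      + (1 - alpha) * (f^`()%classic (w s) * w^`()%classic s) ^+ 2
    = (alpha * f^`(2)%classic (w s) + (1 - alpha) *
        (f^`()%classic (w s) ^+ 2 - f^`()%classic (w s)))
      * w^`()%classic s ^+ 2 by ring.
  by rewrite mulr_ge0// sqr_ge0.
- by move=> s s01; rewrite Lv.
- by rewrite /= w0 v0.
- by rewrite /= w1 v1.
- by rewrite in_itv.
Qed.
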